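(* Let $n\ge 2$, $h>0$, and let $x_1,\dots,x_n$ be equally spaced real nodes, $x_{i+1}=x_i+h$. Let $$S_n(f)=a_1 f(x_1)+\sum_{j=2}^{n} a_j\, f[x_1,x_2,\ldots,x_j]$$ be the rule of model A, where the real weights $a_1,\dots,a_n$ (not depending on $f$) are such that $S_n$ is interpolatory for approximating $I(f)=\int_{x_1}^{x_n} f(x)\,dx$. Then $$a_i=I(w_{i-1})=\int_0^{(n-1)h} w_{i-1}(t)\,dt,\qquad i=1,2,\ldots,n,$$ where in the last integral the Newton polynomials are written for the translated nodes $0,h,\ldots,(n-1)h$, that is, $w_0(t)=1$ and $w_j(t)=t(t-h)\cdots(t-(j-1)h)$ for $j\ge 1$.
   Context: $f[x_1,\ldots,x_j]$ denotes the divided difference of order $j-1$ of $f$ at the nodes $x_1,\ldots,x_j$. A rule is interpolatory (on $n$ nodes) if it is exact for all real polynomials of degree at most $n-1$, i.e. $S_n(q)=I(q)$ for every such polynomial $q$. The Newton basis associated with the nodes is $w_0(x)=1$, $w_i(x)=w_{i-1}(x)(x-x_i)$ for $i\ge1$; in $I(w_{i-1})$ it is taken for the nodes $x_1,\dots,x_n$. *)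

(* Defs.v *)
From HB Require Import structures.
From mathcomp Require Import all_boot all_order all_algebra.
From mathcomp Require Import all_classical all_reals all_analysis.
Set Implicit Arguments.
Unset Strict Implicit.
Unset Printing Implicit Defensive.
Import Order.TTheory GRing.Theory Num.Theory.
Local Open Scope classical_set_scope.
Local Open Scope ring_scope.

(* Nodes and weights are sequences [nat -> R] numbered from 1; a rule on n
   nodes only reads the entries 1, ..., n. *)

(* [divdiff f x i k] is f[x_i, ..., x_{i+k}], of order k, on k + 1 nodes. *)
Fixpoint divdiff (R : realType) (f : R -> R) (x : nat -> R) (i k : nat) : R :=
  if k is k'.+1 then
    (divdiff f x i.+1 k' - divdiff f x i k') / (x (i + k)%N - x i)
  else f (x i).

Fixpoint newton (R : realType) (x : nat -> R) (i : nat) : {poly R} :=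
  if i is i'.+1 then newton x i' * ('X - (x i)%:P) else 1.

(* Only meant for a <= b: this is the integral over the set [a, b], which is
   not oriented. *)
Definition integral_on (R : realType) (a b : R) (f : R -> R) : R :=
  \int[@lebesgue_measure R]_(t in `[a, b]) f t.

(* f[x_1, ..., x_j] has order j - 1. *)
Definition modelA (R : realType) (n : nat) (x a : nat -> R) (f : R -> R) : R :=
  a 1%N * f (x 1%N) + \sum_(2 <= j < n.+1) a j * divdiff f x 1 j.-1.

Definition interpolatory (R : realType) (n : nat) (S I : (R -> R) -> R) : Prop :=
  forall q : {poly R}, (size q <= n)%N -> S (horner q) = I (horner q).

(* The translated nodes 0, h, ..., (n - 1) h, again numbered from 1. *)
Definition translated_nodes (R : realType) (h : R) (i : nat) : R := i.-1%:R * h.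

Lemma newton_translated (R : realType) (h : R) (j : nat) (t : R) :
  (newton (translated_nodes h) j).[t] = \prod_(0 <= k < j) (t - k%:R * h).
Proof.
elim: j => [|j IHj]; first by rewrite big_nil hornerC.
by rewrite big_nat_recr //= hornerM IHj hornerXsubC.
Qed.

(* Main.v *)
Require Import Defs.
From HB Require Import structures.
From mathcomp Require Import all_boot all_order all_algebra.
From mathcomp Require Import all_classical all_reals all_analysis.
From mathcomp Require Import zify ring.
Import Order.TTheory GRing.Theory Num.Theory.
Import numFieldNormedType.Exports.
Local Open Scope classical_set_scope.
Local Open Scope ring_scope.

(** A rule of model A is read in the Newton basis: its weights are dual to the
    polynomials [newton x 0], ..., [newton x n.-1], because for pairwise
    distinct nodes f[x_1, ..., x_(k+1)] extracts the coefficient of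
    [newton x k] in the interpolation polynomial of f; in particular
    it is 1 on [newton x k] and 0 on the other Newton polynomials
    ([divdiff_newton]).  Hence the rule, applied to [newton x i.-1], returns
    the weight [a i], and exactness on this polynomial, of degree [i.-1 < n],
    says that this weight is its integral.

    The duality rests on one identity, the Leibniz rule for multiplication by a
    linear factor ([divdiff_mul_linear]): when that factor vanishes at the first
    node, it cancels that node and lowers the order by one.  Removing the first
    factor of [newton x m.+1] therefore turns the claim for [m.+1] into the
    claim for [m] on the nodes x_2, x_3, ...

    The second equality is the substitution t |-> t + x_1
    ([integral_on_shift], [newton_shift]), which carries the
    nodes 0, h, ..., (n - 1) h to x_1, ..., x_n and [0, (n - 1) h] to
    [x_1, x_n]. *)

Lemma divdiff_succ (R : realType) (f : R -> R) (x : nat -> R) (k i : nat) :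
  divdiff f (x \o succn) i k = divdiff f x i.+1 k.
Proof. by elim: k i => [//|k IHk] i /=; rewrite !IHk. Qed.

Lemma divdiff_cst (R : realType) (c : R) (x : nat -> R) (k i : nat) :
  divdiff (fun=> c) x i k = if k is 0 then c else 0.
Proof.
elim: k i => [//|k IHk] i /=; rewrite !IHk.
by case: k {IHk} => *; rewrite subrr mul0r.
Qed.

(** In the Leibniz rule for divided differences only two terms survive, since
    the factor t - c has vanishing divided differences of order at least 2. *)
Lemma divdiff_mul_linear (R : realType) (f : R -> R) (c : R) (x : nat -> R)
    (k i : nat) :
  (forall p q : nat, (i <= p < q)%N -> (q <= i + k.+1)%N -> x q != x p) ->
  divdiff (fun t => (t - c) * f t) x i k.+1 =
    (x i - c) * divdiff f x i k.+1 + divdiff f x i.+1 k.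
Proof.
elim: k i => [|k IHk] i x_inj.
  rewrite /= addn1.
  have x_neq : x i.+1 - x i != 0 by rewrite subr_eq0 x_inj //; lia.
  by field.
have IHl := IHk i; have IHr := IHk i.+1.
set g := (X in divdiff X) in IHl IHr *.
rewrite [LHS]/= -/(divdiff g x i.+1 k.+1) -/(divdiff g x i k.+1).
rewrite {}IHr; last by move=> p q *; apply: x_inj; lia.
rewrite {}IHl; last by move=> p q *; apply: x_inj; lia.
have x_neq : x (i + k.+2)%N - x i != 0 by rewrite subr_eq0 x_inj //; lia.
have x_neq1 : x (i + k.+2)%N - x i.+1 != 0 by rewrite subr_eq0 x_inj //; lia.
(* f[x_(i+2), ..] is eliminated by the recurrence that defines
   f[x_(i+1), ..., x_(i+k+2)]. *)
have recr : divdiff f x i.+2 k =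
    divdiff f x i.+1 k.+1 * (x (i + k.+2)%N - x i.+1) + divdiff f x i.+1 k.
  by rewrite [in RHS]/= addSnnS divfK // subrK.
rewrite recr.
have -> : divdiff f x i k.+2 =
  (divdiff f x i.+1 k.+1 - divdiff f x i k.+1) / (x (i + k.+2)%N - x i) by [].
move: (divdiff f x i.+1 k.+1) (divdiff f x i k.+1) (divdiff f x i.+1 k) => A B C.
by field.
Qed.

Lemma newton_recl (R : realType) (x : nat -> R) (m : nat) :
  newton x m.+1 = ('X - (x 1%N)%:P) * newton (x \o succn) m.
Proof.
elim: m => [|m IHm]; first by rewrite /= mul1r mulr1.
by rewrite -[LHS]/(newton x m.+1 * _) IHm -mulrA.
Qed.

Lemma size_newton (R : realType) (x : nat -> R) (m : nat) :
  size (newton x m) = m.+1.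
Proof.
elim: m => [|m IHm]; first by rewrite size_poly1.
have newton_neq0 : newton x m != 0 by rewrite -size_poly_gt0 IHm.
by rewrite /= size_Mmonic ?monicXsubC // IHm size_XsubC addn2.
Qed.

(** The induction on [m] changes the nodes: the factor t - x_1 is traded for the
    removal of the node x_1, so the nodes are universally quantified in it. *)
Lemma divdiff_newton (R : realType) (x : nat -> R) (m k : nat) :
  (forall p q : nat, (1 <= p < q)%N -> (q <= k.+1)%N -> x q != x p) ->
  divdiff (horner (newton x m)) x 1 k = (k == m)%:R.
Proof.
elim: m k x => [|m IHm] k x x_inj.
  have -> : horner (newton x 0) = fun=> 1 by apply/funext => t; rewrite hornerC.
  by rewrite divdiff_cst; case: k {x_inj}.
have -> : horner (newton x m.+1) =
    fun t => (t - x 1%N) * (newton (x \o succn) m).[t].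
  by apply/funext => t; rewrite newton_recl hornerM hornerXsubC.
case: k x_inj => [|k] x_inj; first by rewrite /= subrr mul0r.
rewrite divdiff_mul_linear; last by move=> p q *; apply: x_inj; lia.
rewrite subrr mul0r add0r -divdiff_succ IHm ?eqSS //.
by move=> p q *; apply: x_inj; lia.
Qed.

Lemma modelA_newton (R : realType) (n : nat) (x a : nat -> R) (i : nat) :
  (forall p q : nat, (1 <= p < q)%N -> (q <= n)%N -> x q != x p) ->
  (1 <= i <= n)%N -> modelA n x a (horner (newton x i.-1)) = a i.
Proof.
move=> x_inj /andP[i_gt0 le_in].
have -> : modelA n x a (horner (newton x i.-1)) =
    \sum_(1 <= j < n.+1) a j * divdiff (horner (newton x i.-1)) x 1 j.-1.
  by rewrite big_ltn ?ltnS //; apply: leq_trans le_in.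
rewrite (eq_big_nat _ _ (F2 := fun j => if j == i then a j else 0)).
  by rewrite -big_mkcond big_nat1_eq i_gt0 ltnS le_in.
move=> j /andP[j_gt0 le_jn]; rewrite divdiff_newton; last first.
  by move=> p q *; apply: x_inj; lia.
have -> : (j.-1 == i.-1) = (j == i) by lia.
by case: eqP; rewrite ?mulr1 ?mulr0.
Qed.

Lemma newton_shift (R : realType) (x y : nat -> R) (c t : R) (m : nat) :
  (forall i : nat, (1 <= i <= m)%N -> x i = y i + c) ->
  (newton x m).[t + c] = (newton y m).[t].
Proof.
elim: m => [|m IHm] xy; first by rewrite !hornerC.
rewrite /= !hornerM !hornerXsubC IHm => [|i ?]; last by apply: xy; lia.
by rewrite (xy m.+1) ?ltnSn //; ring.
Qed.

Lemma integral_on_shift (R : realType) (a b c : R) (f : R -> R) :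
  a <= b -> continuous f ->
  integral_on (a + c) (b + c) f = integral_on a b (fun t => f (t + c)).
Proof.
move=> le_ab f_cont; rewrite /integral_on /Rintegral; congr fine.
pose F (t : R) := t + c.
have dF : derive1 F = cst 1.
  apply/funext => t; rewrite derive1E /F deriveD //.
  by rewrite derive_id derive_cst addr0.
rewrite -[a + c]/(F a) -[b + c]/(F b) integration_by_substitution_increasing //.
- by apply: eq_integral => t _; rewrite dF /= mulr1.
- by move=> s t _ _ ?; rewrite ltrD2r.
- by rewrite dF => t _; apply: cst_continuous.
- by rewrite dF; apply: is_cvg_cst.
- by rewrite dF; apply: is_cvg_cst.
- have F_cont : continuous F.
    by move=> t; apply: cvgD; [exact: cvg_id|exact: cvg_cst].
  split.
  + by move=> t _; apply: derivableD.
  + exact: cvg_at_right_filter (F_cont a).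
  + exact: cvg_at_left_filter (F_cont b).
- exact: continuous_subspaceT.
Qed.

Theorem proposition2p1 (R : realType) (n : nat) (h : R) (x a : nat -> R)
    (hn : (2 <= n)%N) (hh : 0 < h)
    (hx : forall i : nat, (1 <= i < n)%N -> x i.+1 = x i + h)
    (hS : interpolatory n (modelA n x a) (integral_on (x 1%N) (x n))) :
  forall i : nat, (1 <= i <= n)%N ->
    a i = integral_on (x 1%N) (x n) (fun t => (newton x i.-1).[t]) /\
    integral_on (x 1%N) (x n) (fun t => (newton x i.-1).[t]) =
      integral_on 0 (n.-1%:R * h)
        (fun t => (newton (translated_nodes h) i.-1).[t]).
Proof.
have x_translated j : (1 <= j <= n)%N -> x j = translated_nodes h j + x 1%N.
  rewrite /translated_nodes; case: j => // j /= lt_jn.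
  elim: j lt_jn => [|j IHj] lt_jn; first by rewrite mul0r add0r.
  by rewrite hx // IHj 1?ltnW // -natr1; ring.
have x_inj p q : (1 <= p < q)%N -> (q <= n)%N -> x q != x p.
  move=> lt_pq le_qn; rewrite (x_translated q) 1?(x_translated p); [|lia|lia].
  rewrite (inj_eq (addIr _)) (inj_eq (mulIf (lt0r_neq0 hh))) eqr_nat; lia.
move=> i hi; split.
  rewrite -(@modelA_newton R n x a i) // hS // size_newton; lia.
rewrite -{1}[x 1%N]add0r (x_translated n); last by lia.
rewrite integral_on_shift; last exact: continuous_horner.
  congr integral_on; apply/funext => t.
  by apply: newton_shift => j hj; apply: x_translated; lia.
by rewrite mulr_ge0 // ltW.
Qed.
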